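(* Let $X$ be a locally convex Hausdorff topological vector space, and let $g,h:X\to\overline{\mathbb R}$ be proper generalized polyhedral convex functions given by $$g(x)=\max_{i\in I}\big[\langle u_i^*,x\rangle+\alpha_i\big]\ \ \forall x\in\mathrm{dom}\,g,\qquad h(x)=\max_{j\in J}\big[\langle v_j^*,x\rangle+\beta_j\big]\ \ \forall x\in\mathrm{dom}\,h,$$ where $I=\{1,\dots,m\}$, $J=\{1,\dots,q\}$, $u_i^*,v_j^*\in X^*$, $\alpha_i,\beta_j\in\mathbb R$. Let $C\subset X$ be a nonempty convex set. Then a point $\bar x\in \mathrm{int}(\mathrm{dom}\,g)\cap\mathrm{int}(\mathrm{dom}\,h)\cap C$ is a local solution of the problem of minimizing $f(x):=g(x)-h(x)$ over $x\in C$ if and only if $$\mathrm{co}\{v_j^*\mid j\in J(\bar x)\}\subset \mathrm{co}\{u_i^*\mid i\in I(\bar x)\}+N_C(\bar x),$$ where $I(\bar x)=\{i\in I\mid \langle u_i^*,\bar x\rangle+\alpha_i=g(\bar x)\}$ and $J(\bar x)=\{j\in J\mid \langle v_j^*,\bar x\rangle+\beta_j=h(\bar x)\}$.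
   Context: $\overline{\mathbb R}=\mathbb R\cup\{\pm\infty\}$, with the convention $(+\infty)-(+\infty)=+\infty$. $X^*$ is the topological dual of $X$. $\mathrm{dom}\,\varphi=\{x\mid\varphi(x)<+\infty\}$, $\mathrm{epi}\,\varphi=\{(x,\alpha)\in X\times\mathbb R\mid x\in\mathrm{dom}\,\varphi,\ \varphi(x)\le\alpha\}$; $\varphi$ is proper if $\mathrm{dom}\,\varphi\ne\emptyset$ and $\varphi>-\infty$ everywhere. $\mathrm{int}$ denotes interior, $\mathrm{co}$ the convex hull. A subset of a locally convex Hausdorff topological vector space $Z$ is generalized polyhedral convex if it has the form $\{z\in L\mid \langle z_k^*,z\rangle\le\gamma_k,\ k=1,\dots,p\}$ with $L\subset Z$ a closed affine subspace, $z_k^*\in Z^*$, $\gamma_k\in\mathbb R$. A function is generalized polyhedral convex if its epigraph is a generalized polyhedral convex set in $X\times\mathbb R$; every proper generalized polyhedral convex function has a generalized polyhedral convex domain and is a maximum of finitely many continuous affine functions on that domain. $N_C(\bar x)=\{x^*\in X^*\mid\langle x^*,x-\bar x\rangle\le0\ \forall x\in C\}$. A point $\bar x\in C$ is a local solution if there is a neighborhood $U$ of $\bar x$ with $f(\bar x)\le f(x)$ for all $x\in C\cap U$. *)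

(* Defs.v *)
From HB Require Import structures.
From mathcomp Require Import all_boot all_order all_algebra.
From mathcomp Require Import all_classical all_reals all_analysis.

Set Implicit Arguments.
Unset Strict Implicit.
Unset Printing Implicit Defensive.

Import Order.TTheory GRing.Theory Num.Theory.
Import numFieldNormedType.Exports.

Local Open Scope classical_set_scope.
Local Open Scope ring_scope.

Section Dual.
Context (R : realType) (X : tvsType R).

Definition lincont : {pred X -> R^o} :=
  mem [set f : X -> R^o | linear f /\ continuous f].

Lemma lincont_submod_closed : submod_closed lincont.
Proof.
split.
  rewrite inE; split; first by move=> a x y; rewrite /GRing.zero /= scaler0 addr0.
  by move=> x; apply: cst_continuous.
move=> a f g; rewrite !inE => -[lf cf] [lg cg]; split.
  move=> b x y; rewrite !fctE lf lg !scalerDr !scalerA (mulrC a b).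
  by rewrite addrACA.
move=> x; apply: cvgD; last exact: cg.
by apply: cvgZl_tmp; exact: cf.
Qed.

HB.instance Definition _ :=
  GRing.isSubmodClosed.Build R (X -> R^o) lincont lincont_submod_closed.

(* The topological dual of [X], with pointwise operations. *)
Record dual := Dual { dual_fun :> X -> R^o ; _ : dual_fun \in lincont }.

HB.instance Definition _ := [isSub for dual_fun].
HB.instance Definition _ := [Choice of dual by <:].
HB.instance Definition _ := [SubChoice_isSubLmodule of dual by <:].

End Dual.

Section ConvexAnalysis.
Context (R : realType).

Definition conv_hull (V : lmodType R) (A : set V) : set V :=
  smallest (fun B : set V => convex_set (B : set (convex_lmodType V))) A.

Definition minkowski_sum (V : lmodType R) (A B : set V) : set V :=
  [set a + b | a in A & b in B].

(* The empty set is allowed; it is generalized polyhedral convex anyway, as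
   {z | <0, z> <= -1}. *)
Definition affine_subspace (V : lmodType R) (L : set V) : Prop :=
  forall (x y : V) (t : R), L x -> L y -> L ((1 - t) *: x + t *: y).

Definition gen_polyhedral_set (Z : tvsType R) (A : set Z) : Prop :=
  exists (L : set Z) (p : nat) (z : 'I_p -> dual Z) (gamma : 'I_p -> R),
    [/\ closed L, affine_subspace L &
        A = [set x | L x /\ forall k, z k x <= gamma k]].

Definition edom (X : Type) (f : X -> \bar R) : set X :=
  [set x | (f x < +oo)%E].

Definition epi (X : tvsType R) (f : X -> \bar R) : set (X * R^o) :=
  [set z | edom f z.1 /\ (f z.1 <= (z.2 : R)%:E)%E].

Definition proper_fun (X : Type) (f : X -> \bar R) : Prop :=
  edom f !=set0 /\ forall x, (-oo < f x)%E.

Definition gen_polyhedral_fun (X : tvsType R) (f : X -> \bar R) : Prop :=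
  gen_polyhedral_set (epi f).

Definition normal_cone (X : tvsType R) (C : set X) (x0 : X) : set (dual X) :=
  [set f : dual X | forall x, C x -> f (x - x0) <= 0].

(* The dual subtraction of [\bar R] follows (+oo) - (+oo) = +oo, whereas the
   primal one yields -oo. *)
Definition esub (X : Type) (g h : X -> \bar R) : X -> \bar R :=
  fun x => (g x - h x)%dE.

Definition local_solution (X : tvsType R) (f : X -> \bar R) (C : set X)
    (x0 : X) : Prop :=
  C x0 /\ exists2 U : set X, nbhs x0 U & forall x, (C `&` U) x -> (f x0 <= f x)%E.

(* Only meaningful for 0 < n: the maximum over the empty family is -oo. *)
Definition max_affine (X : tvsType R) (n : nat) (u : 'I_n -> dual X)
    (alpha : 'I_n -> R) (x : X) : \bar R :=
  (\big[maxe/-oo]_(i < n) (u i x + alpha i)%R%:E)%E.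

Definition active (X : tvsType R) (n : nat) (u : 'I_n -> dual X)
    (alpha : 'I_n -> R) (g : X -> \bar R) (x : X) : set 'I_n :=
  [set i | (u i x + alpha i)%:E = g x].

End ConvexAnalysis.

(* Main.v *)
From HB Require Import structures.
Require Import Defs.
From mathcomp Require Import all_boot all_order all_algebra.
From mathcomp Require Import all_classical all_reals all_analysis.
From mathcomp Require Import ring lra.

Import Order.TTheory GRing.Theory Num.Theory.
Import numFieldNormedType.Exports.

Local Open Scope classical_set_scope.
Local Open Scope ring_scope.

(** Near [x0] the inactive affine pieces of [g] stay strictly below the active
    ones, so [g x = g x0 + max (u i (x - x0))] over the active [i], and likewise
    for [h] ([max_affine_germ]).  Both maxima are positively
    homogeneous in [x - x0], and [C] contains the segment from [x0] to each of
    its points; hence local minimality of [g - h] on [C] says exactly that for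
    every active [v j] and every [x] in [C], near or far, some active [u i]
    satisfies [v j (x - x0) <= u i (x - x0)].

    The inclusion says that a single [a] in the hull of the active [u i] can be
    chosen for all [x] in [C]: [v j - a] lies in the normal cone as soon as
    [v j <= a] on [C - x0].  Going from the inclusion to the inequalities is easy,
    because at a given direction an element of a convex hull is bounded by one
    of the generators ([conv_hull_exists_ge]).

    The converse exchange of quantifiers, [conv_hull_dominates], is a theorem of
    the alternative on the convex set [C - x0].  It involves finitely many
    functionals only, and is proved by induction on their number from the case
    of two functionals ([convex_comb_ge0]), where the weight is the supremum of
    the lower bounds imposed on it.  Since the sum of the hull and the normal
    cone is convex, it suffices to treat each generator [v j] of the left-hand
    hull. *)

(** * Convex combinations *)

Lemma ltr_comb {R : realDomainType} (t x x' y y' : R) :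
  0 <= t <= 1 -> x < x' -> y < y' -> t * x + (1 - t) * y < t * x' + (1 - t) * y'.
Proof.
move=> /andP[t0 t1] xx' yy'; have [->|tN0] := eqVneq t 0; first by lra.
have tgt0 : 0 < t by rewrite lt_neqAle eq_sym tN0.
by rewrite ltr_leD ?ltr_pM2l// ler_wpM2l ?subr_ge0// ltW.
Qed.

Lemma comb_id {R : pzRingType} (t x : R) : t * x + (1 - t) * x = x.
Proof. by rewrite -mulrDl addrCA subrr addr0 mul1r. Qed.

Section Convexity.
Context {R : realType} {V : lmodType R}.
Implicit Types (A B : set V).

(** Replaces the bundled coefficients of [convex_set] by real numbers with
    explicit bounds, which arithmetic tactics can handle. *)
Lemma convex_setP A :
  convex_set (A : set (convex_lmodType V)) <->
  forall x y (t : R), 0 <= t <= 1 -> A x -> A y -> A (t *: x + (1 - t) *: y).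
Proof.
split=> [cA x y t /andP[t0 t1] Ax Ay|cA x y t]; last first.
  by rewrite !inE => Ax Ay; apply: cA => //; rewrite ge0 le1.
have t01 : Itv.spec (@Itv.num_sem R) (Itv.Real `[0%Z, 1%Z]%R) t.
  by rewrite /Itv.spec /Itv.num_sem /= in_itv /= num_real t0 t1.
have /= := cA x y (Itv.mk t01).
by rewrite !inE; exact.
Qed.

Lemma conv_hull_convex A :
  convex_set (conv_hull A : set (convex_lmodType V)).
Proof.
apply/convex_setP => x y t t01 Ax Ay B [cB AB].
by move/convex_setP : (cB); apply => //; [exact: Ax|exact: Ay].
Qed.

Lemma minkowski_sum_convex A B :
  convex_set (A : set (convex_lmodType V)) ->
  convex_set (B : set (convex_lmodType V)) ->
  convex_set (minkowski_sum A B : set (convex_lmodType V)).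
Proof.
move=> /convex_setP cA /convex_setP cB; apply/convex_setP.
move=> _ _ t t01 [a Aa [b Bb <-]] [a' Aa' [b' Bb' <-]].
exists (t *: a + (1 - t) *: a'); first exact: cA.
exists (t *: b + (1 - t) *: b'); first exact: cB.
by rewrite !scalerDr addrACA.
Qed.

End Convexity.

(** * Finite families of functionals on a convex set *)

Section Dual.
Context {R : realType} {X : tvsType R}.
Implicit Types (f a v w p q : dual X) (D C : set X).

Lemma dual_lincont f : linear f /\ continuous f.
Proof. by have := valP f; rewrite inE. Qed.

HB.instance Definition _ f :=
  GRing.isLinear.Build R X R^o *:%R f (dual_lincont f).1.

Lemma dual_combE f w (s t : R) x :
  (s *: f + t *: w) x = s * f x + t * w x.
Proof. by []. Qed.

Lemma dual_linear_comb f x y (s t : R) : f (s *: x + t *: y) = s * f x + t * f y.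
Proof. by rewrite linearD !linearZ. Qed.

Lemma normal_cone_convex C x0 :
  convex_set (normal_cone C x0 : set (convex_lmodType (dual X))).
Proof.
apply/convex_setP => f w t /andP[t0 t1] Nf Nw x Cx.
rewrite dual_combE; have := Nf x Cx; have := Nw x Cx; nra.
Qed.

(** A point [e] with [q e < 0 <= p e] requires
    [t >= q e / (q e - p e)]; a point [d] with [p d < 0 <= q d] requires
    [t <= q d / (q d - p d)].  These requirements are compatible: if a lower bound
    exceeded an upper bound, the point of the segment [d, e] at which [p] and [q]
    agree would make both negative.  The supremum of the lower bounds therefore
    works. *)
Lemma convex_comb_ge0 D p q :
  convex_set (D : set (convex_lmodType X)) ->
  (forall d, D d -> 0 <= p d \/ 0 <= q d) ->
  exists2 t : R, 0 <= t <= 1 & forall d, D d -> 0 <= t * p d + (1 - t) * q d.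
Proof.
move=> /convex_setP cD pq_ge0.
(* Adding 0 makes the set of lower bounds nonempty and its supremum >= 0. *)
pose S : set R := 0 |` [set q e / (q e - p e) | e in [set e | D e /\ q e < 0]].
have S0 : S !=set0 by exists 0; left.
have leS r : 0 <= r ->
    (forall e, D e -> q e < 0 -> 0 <= p e -> q e / (q e - p e) <= r) ->
    forall s, S s -> s <= r.
  move=> r0 rP s [->//|[e [De qe0] <-]]; apply: rP => //.
  by case: (pq_ge0 e De) => //; rewrite leNgt qe0.
have S1 : ubound S 1.
  apply: leS => // e De qe0 pe0.
  have d0 : q e - p e < 0 by lra.
  by rewrite ler_ndivrMr// mul1r; lra.
have hS : has_sup S by split => //; exists 1.
have supS := sup_upper_bound hS.
exists (sup S) => [|d Dd].
  by rewrite (ge_sup S0 S1) supS //; left.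
have [pd0|pd0] := leP 0 (p d).
  have [qd0|qd0] := leP 0 (q d).
    have s0 : 0 <= sup S by apply: supS; left.
    have s1 : sup S <= 1 by exact: ge_sup.
    nra.
  have : q d / (q d - p d) <= sup S by apply: supS; right; exists d.
  have d0 : q d - p d < 0 by lra.
  by rewrite ler_ndivrMr//; lra.
have qd0 : 0 <= q d by case: (pq_ge0 d Dd) => //; rewrite leNgt pd0.
have d0 : 0 < q d - p d by lra.
suff : sup S <= q d / (q d - p d) by rewrite ler_pdivlMr//; lra.
apply: ge_sup => //; apply: leS => [|e De qe0 pe0].
  by rewrite divr_ge0 // ltW.
have e0 : q e - p e < 0 by lra.
rewrite ler_ndivrMr// mulrAC ler_pdivrMr// leNgt; apply/negP => lt_cross.
(* The weight for which p and q take the same value at t d + (1 - t) e; that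
   value has the sign of q d * p e - q e * p d. *)
pose t := (p e - q e) / ((p e - q e) + (q d - p d)).
have D0 : 0 < (p e - q e) + (q d - p d) by lra.
have t01 : 0 <= t <= 1.
  by rewrite /t divr_ge0 ?ler_pdivrMr ?mul1r//=; lra.
have tE : t * ((p e - q e) + (q d - p d)) = p e - q e by rewrite divfK ?gt_eqF.
have [] := pq_ge0 _ (cD d e t t01 Dd De); rewrite dual_linear_comb leNgt => /negP; apply.
  rewrite -(pmulr_rlt0 _ D0); nra.
rewrite -(pmulr_rlt0 _ D0); nra.
Qed.

(** Theorem of the alternative: pointwise domination of [v] on [D] by members of
    a finite family yields domination by one convex combination.  The induction
    removes one functional [w] and passes to the convex subset of [D] on which
    [w] fails to dominate; there a combination [a] of the remaining functionals
    dominates, so on all of [D] one of [w - v] and [a - v] is nonnegative, which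
    is the two-functional case. *)
Lemma conv_hull_dominates D (A : set (dual X)) v :
  convex_set (D : set (convex_lmodType X)) -> D !=set0 -> finite_set A ->
  (forall d, D d -> exists2 w, A w & v d <= w d) ->
  exists2 a, conv_hull A a & forall d, D d -> v d <= a d.
Proof.
move=> + + /finite_seqP[s ->] {A}; elim: s D => [|w s IHs] D cD [d0 Dd0] domD.
  by have [] := domD _ Dd0.
pose D' := D `&` [set d | w d < v d].
have hullw : conv_hull [set` w :: s] w.
  by apply: sub_gen_smallest => /=; rewrite mem_head.
have [D'0|nD'] := pselect (D' !=set0); last first.
  exists w => // d Dd; rewrite leNgt; apply/negP => wv.
  by apply: nD'; exists d.
have cD' : convex_set (D' : set (convex_lmodType X)).
  apply/convex_setP => x y t t01 [Dx wx] [Dy wy]; split.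
    by move/convex_setP : cD; apply.
  by rewrite /= !dual_linear_comb; exact: ltr_comb.
have [d [Dd wd]|a hulla aP] := IHs D' cD' D'0.
  have [w' /=] := domD d Dd; rewrite inE => /orP[/eqP ->|sw' vw'].
    by rewrite leNgt wd.
  by exists w'.
have [d Dd|t t01 tP] := convex_comb_ge0 D (w - v) (a - v) cD.
  have [vw|wv] := leP (v d) (w d); first by left; rewrite subr_ge0.
  by right; rewrite subr_ge0; apply: aP.
exists (t *: w + (1 - t) *: a) => [|d Dd].
  have /convex_setP := conv_hull_convex [set` w :: s]; apply => //.
  move: a hulla {aP tP}; apply: sub_smallest2r; first exact: conv_hull_convex.
  by move=> f /= sf; rewrite inE sf orbT.
rewrite dual_combE; have := tP d Dd.
rewrite -[(w - v) d]/(w d - v d) -[(a - v) d]/(a d - v d); lra.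
Qed.

(** Otherwise the generators would all lie in the half-space of functionals
    smaller than [a] at [d], which is convex and does not contain [a]. *)
Lemma conv_hull_exists_ge (A : set (dual X)) a d :
  conv_hull A a -> exists2 w, A w & a d <= w d.
Proof.
move=> hulla; apply: contrapT => noA.
suff : [set b : dual X | b d < a d] a by rewrite /= ltxx.
apply: (hulla [set b : dual X | b d < a d]); split => [|w Aw /=].
  apply/convex_setP => b b' t t01 bd b'd; rewrite /mkset dual_combE.
  by rewrite -[ltRHS](comb_id t); exact: ltr_comb.
by rewrite ltNge; apply/negP => aw; apply: noA; exists w.
Qed.

End Dual.

(** * Local behaviour *)

Section Germ.
Context {R : realType} {X : tvsType R}.

(** The maximising index [i] at [x] near [x0] is active at [x0]: by continuity
    every inactive piece remains strictly below a fixed active piece [k].  Hence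
    [g x - g x0] is the largest increment among the active functionals. *)
Lemma max_affine_germ n (u : 'I_n -> dual X) (alpha : 'I_n -> R)
    (g : X -> \bar R) (x0 : X) :
  proper_fun g -> (forall x, edom g x -> g x = max_affine u alpha x) ->
  (edom g)° x0 ->
  exists2 c : R, g x0 = c%:E & \forall x \near x0,
    exists2 i, active u alpha g x0 i &
      g x = (c + u i (x - x0))%:E /\
      forall k, active u alpha g x0 k -> u k (x - x0) <= u i (x - x0).
Proof.
move=> [_ g_gtNy] gE x0_int.
have le_g x i : edom g x -> ((u i x + alpha i)%:E <= g x)%E.
  by move=> /gE ->; exact: le_bigmax.
have g_attained x : edom g x -> exists i, g x = (u i x + alpha i)%:E.
  move=> gx; have := g_gtNy x; rewrite (gE _ gx) /max_affine.
  (* For n = 0 the maximum is -oo, which properness excludes. *)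
  case: n u alpha {gE le_g} => [|n] u alpha; first by rewrite big_ord0 ltxx.
  move=> _.
  have [|i _ ->] := @eq_bigmax _ (\bar R) 'I_n.+1 -oo%E ord0 xpredT
    (fun i => (u i x + alpha i)%:E) isT; last by exists i.
  by move=> i _; exact: leNye.
have x0_dom : edom g x0 by exact: interior_subset x0_int.
have [k gx0] := g_attained _ x0_dom.
exists (u k x0 + alpha k) => //.
have kact i x : active u alpha g x0 i ->
    u k x0 + alpha k + u i (x - x0) = u i x + alpha i.
  by rewrite /active /= gx0 => -[<-]; rewrite linearB /=; ring.
have inactive : \forall x \near x0, forall i, ~ active u alpha g x0 i ->
    u i x + alpha i < u k x + alpha k.
  apply: filter_forall => i.
  have [ai|nai] := pselect (active u alpha g x0 i).
    by near=> x => /(_ ai).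
  have lt0 : u i x0 + alpha i < u k x0 + alpha k.
    rewrite lt_neqAle -lee_fin -gx0 le_g // andbT.
    by apply/eqP => e; apply: nai; rewrite /active /= gx0 e.
  have cont : {for x0, continuous
      ((fun x => (u k x + alpha k) - (u i x + alpha i)) : X -> R^o)}.
    apply: cvgB; apply: cvgD; try exact: cvg_cst.
      exact: (dual_lincont (u k)).2.
    exact: (dual_lincont (u i)).2.
  have : \forall x \near x0, 0 < (u k x + alpha k) - (u i x + alpha i).
    apply: (cont [set r : R | 0 < r]); apply: open_nbhs_nbhs; split => /=.
      exact: open_gt.
    by rewrite subr_gt0.
  by apply: filterS => x; rewrite subr_gt0.
near=> x.
have gx : edom g x by near: x; exact: x0_int.
have [i gxi] := g_attained _ gx.
have ai : active u alpha g x0 i.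
  apply: contrapT => nai.
  have : u i x + alpha i < u k x + alpha k by move: i nai {gxi}; near: x.
  by rewrite -lte_fin -gxi ltNge le_g.
exists i => //; rewrite kact //; split=> // l al.
rewrite -(lerD2l (u k x0 + alpha k)) !kact //.
by rewrite -lee_fin -gxi le_g.
Unshelve. all: by end_near. Qed.

Lemma near_segment (x0 d : X) (U : set X) :
  nbhs x0 U -> exists2 t : R, 0 < t <= 1 & U (x0 + t *: d).
Proof.
move=> Ux0.
have cont : (fun t : R^o => x0 + t *: d) @ (0 : R^o) --> x0.
  rewrite -[X in _ --> X]addr0 -[X in _ + X](scale0r d).
  apply: (@continuous_comp _ (X * X)%type _ (fun t : R^o => (x0, t *: d))
    (fun z : X * X => z.1 + z.2)); last exact: add_continuous.
  apply: cvg_pair => /=; first exact: cvg_cst.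
  apply: (@continuous_comp _ (R^o * X)%type _ (fun t : R^o => (t, d))
    (fun z : R^o * X => z.1 *: z.2)); last exact: scale_continuous.
  by apply: (@cvg_pair _ _ _ _ (nbhs (0 : R^o))); [exact: cvg_id|exact: cvg_cst].
have near0 : \forall t \near (0 : R^o), U (x0 + t *: d) by exact: cont.
have near0r : \forall t \near (0 : R)^'+, U (x0 + t *: d).
  by rewrite near_withinE; move: near0; apply: filterS => t Ut _.
have : \forall t \near (0 : R)^'+, 0 < t <= 1 /\ U (x0 + t *: d).
  near=> t; split; last by near: t.
  by apply/andP; split; near: t; [exact: nbhs_right_gt|exact: nbhs_right_le].
by move=> /filter_ex[t [t01 Ut]]; exists t.
Unshelve. all: by end_near. Qed.

End Germ.

Theorem theorem3p4 (R : realType) (X : tvsType R)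
    (hausX : hausdorff_space X)
    (g h : X -> \bar R)
    (g_proper : proper_fun g) (g_poly : gen_polyhedral_fun g)
    (h_proper : proper_fun h) (h_poly : gen_polyhedral_fun h)
    (m q : nat)
    (u : 'I_m -> dual X) (alpha : 'I_m -> R)
    (v : 'I_q -> dual X) (beta : 'I_q -> R)
    (gE : forall x, edom g x -> g x = max_affine u alpha x)
    (hE : forall x, edom h x -> h x = max_affine v beta x)
    (C : set X) (C_nonempty : C !=set0)
    (C_convex : convex_set (C : set (convex_lmodType X)))
    (x0 : X) (x0_int : ((edom g)° `&` (edom h)° `&` C) x0) :
  local_solution (esub g h) C x0 <->
  conv_hull [set v j | j in active v beta h x0] `<=`
    minkowski_sum (conv_hull [set u i | i in active u alpha g x0])
                  (normal_cone C x0).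
Proof.
case: x0_int => -[x0g x0h] Cx0.
have [cg gx0 gP] := max_affine_germ _ u alpha g x0 g_proper gE x0g.
have [ch hx0 hP] := max_affine_germ _ v beta h x0 h_proper hE x0h.
split=> [[_ [U Ux0 minU]]|incl]; last first.
  split=> //; apply: ex_intro2 (filterI gP hP) _.
  move=> x [Cx [[i _ [gx i_max]] [j aj [hx _]]]].
  have [|a hulla [b Nb abE]] := incl (v j).
    by apply: sub_gen_smallest; exists j.
  have [_ [k ak <-] auk] := conv_hull_exists_ge _ a (x - x0) hulla.
  have vjE : v j (x - x0) = a (x - x0) + b (x - x0) by rewrite -abE.
  have := i_max k ak; have := Nb x Cx.
  rewrite /esub gx hx gx0 hx0 lee_fin; lra.
apply: (@smallest_sub _ _ _ (minkowski_sum _ _)).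
  apply: minkowski_sum_convex; first exact: conv_hull_convex.
  exact: normal_cone_convex.
move=> _ [j aj <-].
pose D := [set d | C (x0 + d)].
have cD : convex_set (D : set (convex_lmodType X)).
  apply/convex_setP => d d' t t01 Dd Dd'; move/convex_setP : C_convex.
  move=> /(_ _ _ _ t01 Dd Dd'); rewrite /D /=; congr C.
  by rewrite !scalerDr addrACA -scalerDl [t + _]addrC subrK scale1r.
have [||d Dd|a hulla aP] := conv_hull_dominates D
    [set u i | i in active u alpha g x0] (v j) cD.
- by exists 0; rewrite /D /= addr0.
- by apply: finite_image.
(* By homogeneity, the inequality at t d for one t > 0 gives it at d. *)
- have [t /andP[t0 t1] [Ut [[i ai [gx _]] [k _ [hx k_max]]]]] :=
    near_segment x0 d _ (filterI Ux0 (filterI gP hP)).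
  exists (u i); first by exists i.
  have Ct : C (x0 + t *: d).
    have /convex_setP := C_convex => /(_ (x0 + d) x0 t).
    rewrite (ltW t0) t1 => /(_ isT Dd Cx0); congr C.
    by rewrite scalerDr addrAC -scalerDl [t + _]addrC subrK scale1r.
  have := minU _ (conj Ct Ut); have := k_max j aj.
  rewrite /esub gx0 hx0 gx hx lee_fin [x0 + _]addrC addrK !linearZ /= => vk gr.
  rewrite -(ler_pM2l t0) -[leLHS]/(t *: v j d) -[leRHS]/(t *: u i d); lra.
exists a => //; exists (v j - a); last by rewrite addrC subrK.
move=> x Cx; rewrite -[_ (x - x0)]/(v j (x - x0) - a (x - x0)) subr_le0.
by apply: aP; rewrite /D /= addrC subrK.
Qed.
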